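(* Let $m\ge 1$ be an integer with $\gcd(3,m)=1$, let $\Bbbk$ be a field, and let $\mathfrak p\subset R=\Bbbk[[x_1,x_2,x_3]]$ be the defining ideal of the monomial curve parametrized by $(t^{3},t^{3+m},t^{3+2m})$. Then the resurgence of $\mathfrak p$ is $\rho(\mathfrak p)=\frac43$.
   Context: $\mathfrak p$ is the kernel of the $\Bbbk$-algebra map $R\to\Bbbk[[t]]$, $x_1\mapsto t^3$, $x_2\mapsto t^{3+m}$, $x_3\mapsto t^{3+2m}$. Symbolic powers: $\mathfrak p^{(n)}=\mathfrak p^nR_{\mathfrak p}\cap R$. The resurgence is $\rho(\mathfrak p)=\sup\{\,n/r : n,r\ge 1,\ \mathfrak p^{(n)}\not\subseteq\mathfrak p^r\,\}$. *)

(* Defs.v *)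
From HB Require Import structures.
From mathcomp Require Import all_boot all_order all_algebra fraction.
From mathcomp Require Import boolp classical_sets reals.
From mathcomp Require Import mpoly.
(* Not imported, as their notations are incompatible with those of [mpoly]. *)
From mathcomp Require constructive_ereal ereal.

Set Implicit Arguments.
Unset Strict Implicit.
Unset Printing Implicit Defensive.

Import Order.TTheory GRing.Theory Num.Theory.

Local Open Scope classical_set_scope.
Local Open Scope ring_scope.

(* A record, so that the pointwise product of functions is not inferred. *)
Record fps (n : nat) (R : Type) := FPS { fps_coef : 'X_{1..n} -> R }.

Notation "{ 'fps' R [ n ] }" := (fps n R)
  (at level 0, R, n at level 2, format "{ 'fps'  R [ n ] }") : type_scope.

HB.instance Definition _ n R := gen_eqMixin (fps n R).
HB.instance Definition _ n R := gen_choiceMixin (fps n R).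

Lemma fpsP n R (f g : {fps R[n]}) : fps_coef f =1 fps_coef g -> f = g.
Proof. by case: f g => [f] [g] /= /funext ->. Qed.

Section FpsRing.
Context (n : nat) (R : comNzRingType).
Implicit Types f g h : {fps R[n]}.

Definition fps_zero : {fps R[n]} := FPS (fun=> 0).
Definition fps_opp f : {fps R[n]} := FPS (fun u => - fps_coef f u).
Definition fps_add f g : {fps R[n]} :=
  FPS (fun u => fps_coef f u + fps_coef g u).
Definition fps_one : {fps R[n]} := FPS (fun u => (u == 0%MM)%:R).
(* The bound on the degrees only serves to make the index type finite. *)
Definition fps_mul f g : {fps R[n]} := FPS (fun u =>
  \sum_(v : 'X_{1..n < (mdeg u).+1, (mdeg u).+1} | u == (v.1 + v.2)%MM)
    fps_coef f v.1 * fps_coef g v.2).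
Definition fps_scale (c : R) f : {fps R[n]} :=
  FPS (fun u => c * fps_coef f u).

Fact fps_addA : associative fps_add.
Proof. by move=> f g h; apply: fpsP => u /=; rewrite addrA. Qed.
Fact fps_addC : commutative fps_add.
Proof. by move=> f g; apply: fpsP => u /=; rewrite addrC. Qed.
Fact fps_add0 : left_id fps_zero fps_add.
Proof. by move=> f; apply: fpsP => u /=; rewrite add0r. Qed.
Fact fps_addN : left_inverse fps_zero fps_opp fps_add.
Proof. by move=> f; apply: fpsP => u /=; rewrite addNr. Qed.

HB.instance Definition _ :=
  GRing.isZmodule.Build {fps R[n]} fps_addA fps_addC fps_add0 fps_addN.

Definition fps_trunc (d : nat) f : {mpoly R[n]} :=
  \sum_(v : 'X_{1..n < d}) fps_coef f v *: 'X_[v].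

Lemma mcoeff_trunc d f (u : 'X_{1..n}) :
  (fps_trunc d f)@_u = if (mdeg u < d)%N then fps_coef f u else 0.
Proof.
rewrite /fps_trunc raddf_sum /=; case: ifP => hu.
  rewrite (bigD1 (BMultinom hu)) //= mcoeffZ mcoeffX eqxx mulr1 big1 ?addr0 //.
  move=> v; rewrite -val_eqE /= => /negbTE ne.
  by rewrite mcoeffZ mcoeffX ne mulr0.
rewrite big1 // => v _; rewrite mcoeffZ mcoeffX.
by case: eqP => [E|]; rewrite ?mulr0 //; rewrite -E bmdeg in hu.
Qed.

Lemma fps_mul_trunc d f g (P Q : {mpoly R[n]}) u : (mdeg u < d)%N ->
  (forall v : 'X_{1..n}, (mdeg v < d)%N -> P@_v = fps_coef f v) ->
  (forall v : 'X_{1..n}, (mdeg v < d)%N -> Q@_v = fps_coef g v) ->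
  (P * Q)@_u = fps_coef (fps_mul f g) u.
Proof.
move=> hu hP hQ; rewrite mcoeffM; apply: eq_bigr => -[v1 v2] /= _.
by rewrite hP ?hQ //; apply: leq_ltn_trans hu; rewrite -ltnS bmdeg.
Qed.

Fact fps_mulA : associative fps_mul.
Proof.
move=> f g h; apply: fpsP => u; pose d := (mdeg u).+1.
have T k (v : 'X_{1..n}) : (mdeg v < d)%N ->
    (fps_trunc d k)@_v = fps_coef k v.
  by move=> hv; rewrite mcoeff_trunc hv.
have M k l (v : 'X_{1..n}) : (mdeg v < d)%N ->
    (fps_trunc d k * fps_trunc d l)@_v = fps_coef (fps_mul k l) v.
  by move=> hv; apply: (fps_mul_trunc hv) => w; apply: T.
rewrite -(@fps_mul_trunc d _ _ (fps_trunc d f)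
            (fps_trunc d g * fps_trunc d h)) //; [|exact: T|exact: M].
by rewrite mulrA; apply: (@fps_mul_trunc d) => //; [exact: M|exact: T].
Qed.

Fact fps_mulC : commutative fps_mul.
Proof.
move=> f g; apply: fpsP => u; pose d := (mdeg u).+1.
have T k (v : 'X_{1..n}) : (mdeg v < d)%N ->
    (fps_trunc d k)@_v = fps_coef k v.
  by move=> hv; rewrite mcoeff_trunc hv.
rewrite -(@fps_mul_trunc d _ _ (fps_trunc d f) (fps_trunc d g)) //; try exact: T.
by rewrite mulrC; apply: (@fps_mul_trunc d) => //; exact: T.
Qed.

Fact fps_mul1 : left_id fps_one fps_mul.
Proof.
move=> f; apply: fpsP => u; pose d := (mdeg u).+1.
have T k (v : 'X_{1..n}) : (mdeg v < d)%N ->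
    (fps_trunc d k)@_v = fps_coef k v.
  by move=> hv; rewrite mcoeff_trunc hv.
rewrite -(@fps_mul_trunc d _ _ 1 (fps_trunc d f)) ?mul1r ?T //; last exact: T.
by move=> v _; rewrite mcoeff1.
Qed.

Fact fps_mulDl : left_distributive fps_mul fps_add.
Proof.
move=> f g h; apply: fpsP => u /=; rewrite -big_split /=.
by apply: eq_bigr => v _; rewrite mulrDl.
Qed.

Fact fps_one_neq0 : fps_one != 0 :> {fps R[n]}.
Proof.
apply/eqP => /(congr1 (fun f => fps_coef f 0%MM)) /=.
by rewrite eqxx => /eqP; rewrite oner_eq0.
Qed.

HB.instance Definition _ := GRing.Zmodule_isComNzRing.Build {fps R[n]}
  fps_mulA fps_mulC fps_mul1 fps_mulDl fps_one_neq0.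

Fact fps_scaleA a b f : fps_scale a (fps_scale b f) = fps_scale (a * b) f.
Proof. by apply: fpsP => u /=; rewrite mulrA. Qed.
Fact fps_scale1 : left_id 1 fps_scale.
Proof. by move=> f; apply: fpsP => u /=; rewrite mul1r. Qed.
Fact fps_scaleDr : right_distributive fps_scale +%R.
Proof. by move=> a f g; apply: fpsP => u /=; rewrite mulrDr. Qed.
Fact fps_scaleDl f : {morph fps_scale^~ f : a b / a + b}.
Proof. by move=> a b; apply: fpsP => u /=; rewrite mulrDl. Qed.

HB.instance Definition _ := GRing.Zmodule_isLmodule.Build R {fps R[n]}
  fps_scaleA fps_scale1 fps_scaleDr fps_scaleDl.

Fact fps_scaleAl (a : R) f g : a *: (f * g) = a *: f * g.
Proof.
apply: fpsP => u /=; rewrite big_distrr /=.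
by apply: eq_bigr => v _; rewrite mulrA.
Qed.

HB.instance Definition _ :=
  GRing.Lmodule_isLalgebra.Build R {fps R[n]} fps_scaleAl.
HB.instance Definition _ := GRing.Lalgebra_isComAlgebra.Build R {fps R[n]}.

Definition fps_unit : pred {fps R[n]} := fun f => `[< exists g, g * f = 1 >].
Definition fps_inv f : {fps R[n]} :=
  if pselect (exists g, g * f = 1) is left e then sval (cid e) else f.

Fact fps_mulV : {in fps_unit, left_inverse 1 fps_inv *%R}.
Proof.
move=> f /asboolP e; rewrite /fps_inv; case: pselect => // e'.
by case: (cid e').
Qed.
Fact fps_unitP f g : g * f = 1 -> fps_unit f.
Proof. by move=> e; apply/asboolP; exists g. Qed.
Fact fps_inv_out : {in [predC fps_unit], fps_inv =1 id}.
Proof.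
move=> f /asboolP e; rewrite /fps_inv; case: pselect => // e'.
Qed.

HB.instance Definition _ := GRing.ComNzRing_hasMulInverse.Build {fps R[n]}
  fps_mulV fps_unitP fps_inv_out.

Lemma fps_coefD f g u : fps_coef (f + g) u = fps_coef f u + fps_coef g u.
Proof. by []. Qed.

Lemma fps_coefZ a f u : fps_coef (a *: f) u = a * fps_coef f u.
Proof. by []. Qed.

Lemma fps_coef1 u : fps_coef (1 : {fps R[n]}) u = (u == 0%MM)%:R.
Proof. by []. Qed.

Lemma fps_coefM f g u : fps_coef (f * g) u =
  \sum_(v : 'X_{1..n < (mdeg u).+1, (mdeg u).+1} | u == (v.1 + v.2)%MM)
    fps_coef f v.1 * fps_coef g v.2.
Proof. by []. Qed.

Lemma fps_coef_sum I (r : seq I) (P : pred I) (F : I -> {fps R[n]}) u :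
  fps_coef (\sum_(i <- r | P i) F i) u = \sum_(i <- r | P i) fps_coef (F i) u.
Proof. by elim/big_rec2: _ => // i x y _ <-. Qed.

Definition fps_var (i : 'I_n) : {fps R[n]} := FPS (fun u => (u == U_(i)%MM)%:R).

End FpsRing.

Arguments fps_var {n R}.
Arguments fps_add : simpl never.
Arguments fps_opp : simpl never.
Arguments fps_mul : simpl never.
Arguments fps_scale : simpl never.

Section FpsDomain.
Context (n : nat) (R : idomainType).

Lemma fps_low_term (f : {fps R[n]}) : f != 0 ->
  exists u, fps_coef f u != 0 /\
    forall v : 'X_{1..n}, (v < u)%O -> fps_coef f v = 0.
Proof.
move=> f0; apply: contrapT => H; move/eqP: f0; apply; apply: fpsP => u /=.
elim/(well_founded_ind (@ltom_wf n)): u => u IH.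
by apply: contrapT => /eqP hu; apply: H; exists u.
Qed.

Fact fps_integral : GRing.integral_domain_axiom {fps R[n]}.
Proof.
move=> f g fg0; apply: contrapT => /negP; rewrite negb_or => /andP[].
move=> /fps_low_term[a [fa La]] /fps_low_term[b [gb Lb]].
have /eqP : fps_coef (f * g) (a + b)%MM = 0 by rewrite fg0.
have ha : (mdeg a < (mdeg (a + b)%MM).+1)%N by rewrite mdegD ltnS leq_addr.
have hb : (mdeg b < (mdeg (a + b)%MM).+1)%N by rewrite mdegD ltnS leq_addl.
rewrite fps_coefM (bigD1 (BMultinom ha, BMultinom hb)) //= big1 ?addr0.
  by rewrite mulf_eq0 (negbTE fa) (negbTE gb).
move=> -[v1 v2] /= /andP[/eqP E ne].
have [lt|gt|eq] := ltgtP (v1 : 'X_{1..n}) a; first by rewrite La ?mul0r.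
- have [lt2|ge2] := ltP (v2 : 'X_{1..n}) b; first by rewrite Lb ?mulr0.
  have : ((a + b)%MM < (v1 + v2)%MM)%O.
    apply: (@lt_le_trans _ _ (v1 + b)%MM); last by rewrite lemc_add2r.
    by rewrite lt_neqAle lemc_add2l (ltW gt) andbT eqm_add2r (lt_eqF gt).
  by rewrite -E ltxx.
- case/negP: ne; rewrite -pair_eqE /= -!val_eqE /= eq eqxx /=.
  by move: E; rewrite eq => /eqP; rewrite eqm_add2l eq_sym.
Qed.

HB.instance Definition _ :=
  GRing.ComUnitRing_isIntegral.Build {fps R[n]} fps_integral.

End FpsDomain.

(* [fps_subst g f] is [f(g_0, ..., g_(n-1))] for series [g_i] without constant
   term: the monomials of degree greater than [mdeg u] then do not contribute
   to the coefficient at [u]. *)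
Definition fps_subst n q (R : comNzRingType) (g : 'I_n -> {fps R[q]})
    (f : {fps R[n]}) : {fps R[q]} :=
  FPS (fun u => fps_coef
    (\sum_(v : 'X_{1..n < (mdeg u).+1})
       fps_coef f v *: \prod_(i < n) g i ^+ v i) u).

Section Subst.
Context (n q : nat) (R : comNzRingType) (g : 'I_n -> {fps R[q]}).
Hypothesis g0 : forall i, fps_coef (g i) 0%MM = 0.

Definition vanishes d (f : {fps R[q]}) :=
  forall u : 'X_{1..q}, (mdeg u < d)%N -> fps_coef f u = 0.

Lemma vanishesM d e f h :
  vanishes d f -> vanishes e h -> vanishes (d + e) (f * h).
Proof.
move=> Hf Hh u hu; rewrite fps_coefM big1 // => -[v1 v2] /= /eqP E.
have [lt|ge] := ltnP (mdeg v1) d; first by rewrite Hf ?mul0r.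
rewrite Hh ?mulr0 // -(ltn_add2l d); apply: leq_ltn_trans hu.
by apply: leq_trans (eq_leq (esym (congr1 mdeg E))); rewrite mdegD leq_add2r.
Qed.

Lemma vanishes_monom (v : 'X_{1..n}) :
  vanishes (mdeg v) (\prod_(i < n) g i ^+ v i).
Proof.
rewrite mdegE; elim/big_ind2: _ => //; first exact: (fun a b c d x y => vanishesM x y).
move=> i _; elim: (v i) => // d IH; rewrite exprS -add1n; apply: vanishesM => // u.
by rewrite ltnS leqn0 mdeg_eq0 => /eqP ->.
Qed.

Let ev (P : {mpoly R[n]}) : {fps R[q]} := mmap (in_alg {fps R[q]}) g P.

Let ev_cong d (P Q : {mpoly R[n]}) (u : 'X_{1..q}) :
  (forall v : 'X_{1..n}, (mdeg v < d)%N -> P@_v = Q@_v) -> (mdeg u < d)%N ->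
  fps_coef (ev P) u = fps_coef (ev Q) u.
Proof.
move=> PQ hu; apply/eqP; rewrite -subr_eq0; apply/eqP.
transitivity (fps_coef (ev (P - Q)) u); first by rewrite /ev mmapB.
rewrite /ev /mmap fps_coef_sum big1 // => v _.
rewrite [X in fps_coef X](mulr_algl (_ : R)) fps_coefZ.
have [lt|ge] := ltnP (mdeg v) d; first by rewrite mcoeffB PQ // subrr mul0r.
by rewrite (@vanishes_monom v) ?mulr0 //; apply: leq_trans ge.
Qed.

Let substE f u : fps_coef (fps_subst g f) u =
  fps_coef (ev (fps_trunc (mdeg u).+1 f)) u.
Proof.
rewrite [LHS]/=; congr fps_coef; rewrite /ev /fps_trunc raddf_sum.
by apply: eq_bigr => v _; rewrite [RHS]mmapZ mmapX; exact/esym/mulr_algl.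
Qed.

Let substP d (P : {mpoly R[n]}) f u :
  (forall v : 'X_{1..n}, (mdeg v < d)%N -> P@_v = fps_coef f v) ->
  (mdeg u < d)%N -> fps_coef (fps_subst g f) u = fps_coef (ev P) u.
Proof.
move=> hP hu; rewrite substE; apply: (@ev_cong (mdeg u).+1) => // v hv.
by rewrite mcoeff_trunc hv hP //; apply: leq_trans hv _.
Qed.

Let truncP d (f : {fps R[n]}) (v : 'X_{1..n}) : (mdeg v < d)%N ->
  (fps_trunc d f)@_v = fps_coef f v.
Proof. by move=> hv; rewrite mcoeff_trunc hv. Qed.

Lemma fps_subst_is_zmod_morphism : zmod_morphism (fps_subst g).
Proof.
move=> f h; apply: fpsP => u; pose d := (mdeg u).+1.
rewrite (@substP d (fps_trunc d f - fps_trunc d h)) //; last first.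
  by move=> v hv; rewrite mcoeffB !truncP.
by rewrite /ev mmapB /= -!substE.
Qed.

Lemma fps_subst_is_monoid_morphism : monoid_morphism (fps_subst g).
Proof.
split=> [|f h]; apply: fpsP => u; pose d := (mdeg u).+1.
  by rewrite (@substP d 1) /ev ?rmorph1 // => v _; rewrite mcoeff1.
rewrite (@substP d (fps_trunc d f * fps_trunc d h)) //; last first.
  by move=> v hv; apply: (fps_mul_trunc hv); exact: truncP.
rewrite /ev rmorphM !fps_coefM; apply: eq_bigr => -[v1 v2] _ /=.
by congr (_ * _); apply/esym; apply: (@substP d); rewrite ?bmdeg //;
  exact: truncP.
Qed.

Lemma fps_subst_is_scalable : scalable (fps_subst g).
Proof.
move=> a f; apply: fpsP => u; pose d := (mdeg u).+1.
rewrite (@substP d (a *: fps_trunc d f)) //; last first.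
  by move=> v hv; rewrite mcoeffZ truncP.
by rewrite /ev mmapZ [X in fps_coef X](mulr_algl (_ : R)) !fps_coefZ substE.
Qed.

Lemma fps_subst_var i : fps_subst g (fps_var i) = g i.
Proof.
apply: fpsP => u; pose d := (mdeg u).+1.
rewrite (@substP d 'X_i) //; last by move=> v _; rewrite mcoeffX eq_sym.
by rewrite /ev mmapX mmap1U.
Qed.

End Subst.

(* The [k]-algebra map [k[[x_1, x_2, x_3]] -> k[[t]]] with
   [x_1 |-> t^3], [x_2 |-> t^(3+m)] and [x_3 |-> t^(3+2m)]. *)
Definition curve_map (k : comNzRingType) (m : nat) :
    {fps k[3]} -> {fps k[1]} :=
  fps_subst (fun i : 'I_3 => fps_var ord0 ^+ (3 + i * m)).
Arguments curve_map : clear implicits.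

Fact curve_map0 (k : comNzRingType) (m : nat) (i : 'I_3) :
  fps_coef (fps_var ord0 ^+ (3 + i * m) : {fps k[1]}) 0%MM = 0.
Proof.
rewrite exprS fps_coefM big1 // => -[v1 v2] /= /eqP E.
have -> : (v1 : 'X_{1..1}) = 0%MM.
  apply/eqP; rewrite -mdeg_eq0 -leqn0 -[leqRHS](@mdeg0 1).
  by apply: leq_trans (eq_leq (esym (congr1 mdeg E))); rewrite mdegD leq_addr.
by rewrite eq_sym -mdeg_eq0 mdeg1 mul0r.
Qed.

HB.instance Definition _ (k : comNzRingType) m :=
  GRing.isZmodMorphism.Build {fps k[3]} {fps k[1]} (curve_map k m)
    (fps_subst_is_zmod_morphism (curve_map0 k m)).
HB.instance Definition _ (k : comNzRingType) m :=
  GRing.isMonoidMorphism.Build {fps k[3]} {fps k[1]} (curve_map k m)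
    (fps_subst_is_monoid_morphism (curve_map0 k m)).
HB.instance Definition _ (k : comNzRingType) m :=
  GRing.isScalable.Build k {fps k[3]} {fps k[1]} *:%R (curve_map k m)
    (fps_subst_is_scalable (curve_map0 k m)).

Lemma curve_map_var (k : comNzRingType) m (i : 'I_3) :
  curve_map k m (fps_var i) = fps_var ord0 ^+ (3 + i * m).
Proof. exact: (fps_subst_var (curve_map0 k m)). Qed.

Definition curve_ideal (k : comNzRingType) (m : nat) : set {fps k[3]} :=
  [set f | curve_map k m f = 0].
Arguments curve_ideal : clear implicits.

(* The finite sums of products [a * s] with [a] in [A] and [s] in [S]: when [A]
   is a subring, the [A]-submodule generated by [S]. *)
Definition span (R : pzRingType) (A S : set R) : set R :=
  [set x | exists e : seq (R * R),
     (forall y, y \in e -> A y.1 /\ S y.2) /\ x = \sum_(y <- e) y.1 * y.2].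

Definition ideal_pow (R : comNzRingType) (I : set R) (n : nat) : set R :=
  span setT [set x | exists a : 'I_n -> R,
                       (forall i, I (a i)) /\ x = \prod_(i < n) a i].

Local Notation "x %:F" := (@FracField.tofrac _ x).

(* [R_p] as a subring of the fraction field, for a prime ideal [p] of the
   domain [R]. *)
Definition localization (R : idomainType) (p : set R) : set {fraction R} :=
  [set x | exists a s : R, ~ p s /\ x = a%:F / s%:F].

(* [p^n R_p] intersected with [R]. *)
Definition symbolic_pow (R : idomainType) (p : set R) (n : nat) : set R :=
  [set f | span (localization p) [set a%:F | a in ideal_pow p n] f%:F].

(* The supremum is taken in the extended reals since it may be infinite. *)
Definition resurgence (K : realType) (R : idomainType) (p : set R) :
    constructive_ereal.extended K :=
  ereal.ereal_sup [set x | exists n r : nat,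
    [/\ (1 <= n)%N, (1 <= r)%N, ~ (symbolic_pow p n `<=` ideal_pow p r)
      & x = constructive_ereal.EFin (n%:R / r%:R)]].

(* Main.v *)
Require Import Defs.
From mathcomp Require Import all_boot all_order all_algebra.
From mathcomp Require Import boolp classical_sets reals mpoly ring lra zify.
From mathcomp Require constructive_ereal ereal.
(* The notations of these two files are incompatible with those of [mpoly]. *)
Import (canonicals) constructive_ereal ereal.

(** The ideal [p] of the curve is generated by the 2x2 minors [A], [B], [C] of
    [[x, y, z], [y, z, w]], where [w = x^(m+1)]. There is an element [D] of order
    3 with [x D = B^2 - A C], and the symbolic powers satisfy
    [p^((n+2)) = D p^((n)) + C^(n+1) p]. The relation
    [D^2 = 3VABC - VB^3 - V^2C^3 - A^3], [V = x^m], puts [D^2] in [p^3], so that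
    [p^((n))] is contained in [p^r] as soon as [4r <= 3n + 1]; hence the
    resurgence is at most [4/3]. Conversely [D^(2q)] lies in [p^((4q))] and has
    order [6q], while the elements of [p^(3q+1)] have order at least [6q + 2]. *)

Set Implicit Arguments.
Unset Strict Implicit.
Unset Printing Implicit Defensive.

Import Order.TTheory GRing.Theory Num.Theory.
Local Open Scope classical_set_scope.
Local Open Scope ring_scope.

(** * Powers of an ideal *)

Section IdealPower.
Context (R : comNzRingType) (I : set R).
Implicit Types (f g : R) (n : nat).

Lemma ideal_pow_min n (K : set R) : K 0 -> (forall f g, K f -> K g -> K (f + g)) ->
  (forall r (a : 'I_n -> R), (forall i, I (a i)) -> K (r * \prod_(i < n) a i)) ->
  ideal_pow I n `<=` K.
Proof.
move=> K0 KD KP f [e [He ->]]; elim: e He => [|u e IH] He; first by rewrite big_nil.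
rewrite big_cons; apply: KD; last first.
  by apply: IH => v ve; apply: He; rewrite inE ve orbT.
by have [_ [a [Ia ->]]] := He u (mem_head _ _); apply: KP.
Qed.

Lemma ideal_pow_prod n r (a : 'I_n -> R) :
  (forall i, I (a i)) -> ideal_pow I n (r * \prod_(i < n) a i).
Proof.
move=> Ia; exists [:: (r, \prod_(i < n) a i)]; rewrite big_seq1; split=> // u.
by rewrite inE => /eqP ->; split=> //; exists a.
Qed.

Lemma ideal_pow0l n : ideal_pow I n 0.
Proof. by exists [::]; rewrite big_nil. Qed.

Lemma ideal_powD n f g : ideal_pow I n f -> ideal_pow I n g -> ideal_pow I n (f + g).
Proof.
move=> [e [He ->]] [e' [He' ->]]; exists (e ++ e'); rewrite big_cat; split=> // u.
by rewrite mem_cat => /orP[/He|/He'].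
Qed.

Lemma ideal_powMl n r f : ideal_pow I n f -> ideal_pow I n (r * f).
Proof.
move: f; apply: (@ideal_pow_min n (fun f => ideal_pow I n (r * f))).
- by rewrite mulr0; exact: ideal_pow0l.
- by move=> f g; rewrite mulrDr; exact: ideal_powD.
- by move=> s a Ia; rewrite mulrA; exact: ideal_pow_prod.
Qed.

Lemma ideal_pow0 f : ideal_pow I 0 f.
Proof.
have := @ideal_pow_prod 0 f (fun=> 0); rewrite big_ord0 mulr1; apply.
by case.
Qed.

Lemma ideal_powS n f g : I f -> ideal_pow I n g -> ideal_pow I n.+1 (f * g).
Proof.
move=> If; move: g.
apply: (@ideal_pow_min n (fun g => ideal_pow I n.+1 (f * g))).
- by rewrite mulr0; exact: ideal_pow0l.
- by move=> g h; rewrite mulrDr; exact: ideal_powD.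
move=> s a Ia; pose b i := if unlift ord0 i is Some j then a j else f.
have -> : f * (s * \prod_(i < n) a i) = s * \prod_(i < n.+1) b i.
  rewrite big_ord_recl /b unlift_none mulrCA; congr (_ * (_ * _)).
  by apply: eq_bigr => i _; rewrite liftK.
by apply: ideal_pow_prod => i; rewrite /b; case: unliftP.
Qed.

Lemma ideal_powM n n' f g :
  ideal_pow I n f -> ideal_pow I n' g -> ideal_pow I (n + n') (f * g).
Proof.
move=> If Ig; move: f If.
apply: (@ideal_pow_min n (fun f => ideal_pow I (n + n') (f * g))).
- by rewrite mul0r; exact: ideal_pow0l.
- by move=> f h; rewrite mulrDl; exact: ideal_powD.
move=> r a Ia; rewrite -mulrA; apply: ideal_powMl.
elim: n a Ia => [|n IH] a Ia; first by rewrite big_ord0 mul1r.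
by rewrite big_ord_recl -mulrA; apply: ideal_powS => //; exact: IH.
Qed.

Lemma ideal_powX n f j : ideal_pow I n f -> ideal_pow I (n * j) (f ^+ j).
Proof.
move=> If; elim: j => [|j IH]; first by rewrite muln0; exact: ideal_pow0.
by rewrite mulnS exprS; apply: ideal_powM.
Qed.

Lemma ideal_pow1 f : I f -> ideal_pow I 1 f.
Proof. by move=> If; rewrite -[f]mulr1; apply: ideal_powS => //; exact: ideal_pow0. Qed.

Lemma ideal_pow_le n n' : (n <= n')%N -> ideal_pow I n' `<=` ideal_pow I n.
Proof.
move=> le; apply: ideal_pow_min; [exact: ideal_pow0l|exact: ideal_powD|].
move=> r a Ia; apply: ideal_powMl; move: a Ia.
elim: n n' le => [|n IH] [|n'] // le a Ia; try exact: ideal_pow0.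
by rewrite big_ord_recl; apply: ideal_powS => //; exact: IH.
Qed.

End IdealPower.

(** * The minors, [delta] and the filtration [sat] over an arbitrary domain *)

Section Determinantal.
Context (R : idomainType) (x y z v : R).

(** For the curve [v] is x^(m-1), so that V = x^m and w = x^(m+1). Having V as a visible multiple of
    x makes [delta] congruent to z^3 modulo x. *)
Let V := x * v.
Let w := x * V.

Definition minorA := y * w - z ^+ 2.
Definition minorB := y * z - x * w.
Definition minorC := x * z - y ^+ 2.
(** Minus the determinant of the symmetric matrix [[x, y, z], [y, z, w], [z, w, V y]], whose first
    two rows define the minors. *)
Definition delta := z ^+ 3 - 3 * (y * z * w) + x * w ^+ 2 + V * y ^+ 3.

Local Notation A := minorA.
Local Notation B := minorB.
Local Notation C := minorC.
Local Notation D := delta.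

Definition minors : set R :=
  [set f | exists a b c, f = a * A + b * B + c * C].

Local Notation p := minors.

(* For the curve this contains the [n]-th symbolic power: [x * delta] is
   [B^2 - AC], and [sat n] is saturated with respect to [x] ([sat_x]). *)
Fixpoint sat (n : nat) : set R :=
  match n with
  | 0 => setT
  | 1 => p
  | n'.+2 => [set f | exists g h, [/\ sat n' g, p h & f = D * g + C ^+ n'.+1 * h]]
  end.

Lemma nat_ind2 (P : nat -> Prop) :
  P 0%N -> P 1%N -> (forall n, P n -> P n.+1 -> P n.+2) -> forall n, P n.
Proof.
move=> P0 P1 PS n; have [] : P n /\ P n.+1 by elim: n => // n [Pn PSn]; split; auto.
by [].
Qed.

Lemma minorsD f g : p f -> p g -> p (f + g).
Proof.
move=> [a [b [c ->]]] [a' [b' [c' ->]]].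
by exists (a + a'), (b + b'), (c + c'); ring.
Qed.

Lemma minorsMl r f : p f -> p (r * f).
Proof.
by move=> [a [b [c ->]]]; exists (r * a), (r * b), (r * c); ring.
Qed.

Lemma minors_A : p A. Proof. by exists 1, 0, 0; ring. Qed.
Lemma minors_B : p B. Proof. by exists 0, 1, 0; ring. Qed.
Lemma minors_C : p C. Proof. by exists 0, 0, 1; ring. Qed.

Lemma minors_delta : p D.
(* Laplace expansion of the determinant along its last row (z, w, V y). *)
Proof. by exists (- z), (- w), (- (V * y)); rewrite /D /A /B /C /w; ring. Qed.

Lemma satD n f g : sat n f -> sat n g -> sat n (f + g).
Proof.
elim/nat_ind2: n f g => //; first exact: minorsD.
move=> n IH _ f g [f1 [f2 [Hf1 Hf2 ->]]] [g1 [g2 [Hg1 Hg2 ->]]].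
by exists (f1 + g1), (f2 + g2); split; [exact: IH|exact: minorsD|ring].
Qed.

Lemma satMl n r f : sat n f -> sat n (r * f).
Proof.
elim/nat_ind2: n f => //; first exact: minorsMl.
move=> n IH _ f [f1 [f2 [Hf1 Hf2 ->]]].
by exists (r * f1), (r * f2); split; [exact: IH|exact: minorsMl|ring].
Qed.

Lemma sat0 n : sat n 0.
Proof.
elim/nat_ind2: n => //; first by exists 0, 0, 0; ring.
by move=> n IH _; exists 0, 0; split=> //; [exists 0, 0, 0|]; ring.
Qed.

Lemma sat_delta n f : sat n f -> sat n.+2 (D * f).
Proof. by move=> Hf; exists f, 0; split=> //; [exists 0, 0, 0|]; ring. Qed.

Lemma sat_minorCX_mul n h : p h -> sat n.+1 (C ^+ n * h).
Proof.
case: n => [|n] Hh; first by rewrite mul1r.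
by exists 0, h; split=> //; [exact: sat0|ring].
Qed.

Lemma sat_minorCX n : sat n (C ^+ n).
Proof. by case: n => // n; rewrite exprSr; apply: sat_minorCX_mul; exact: minors_C. Qed.

(** The products without a factor C are A^2 = z D + V B C, A B = - y D + V C^2 and B^2 = x D + A C.
    All others are multiples of C by an element of p. *)
Lemma minorsM f g : p f -> p g -> exists r h, p h /\ f * g = D * r + C * h.
Proof.
move=> [a [b [c ->]]] [a' [b' [c' ->]]].
exists (a * a' * z - (a * b' + b * a') * y + b * b' * x).
exists (a * a' * V * B + (a * b' + b * a') * V * C + b * b' * A
   + c * (a' * A + b' * B + c' * C) + c' * (a * A + b * B)); split.
  exists (b * b' + c * a' + c' * a), (a * a' * V + c * b' + c' * b).
  by exists ((a * b' + b * a') * V + c * c'); ring.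
by rewrite /D /A /B /C /w /V; ring.
Qed.

Lemma sat_mul n f g : p f -> sat n g -> sat n.+1 (f * g).
Proof.
move=> Hf; elim/nat_ind2: n g => [g _|g Hg|n IH _ g [g1 [g2 [Hg1 Hg2 ->]]]].
- by rewrite mulrC; exact: minorsMl.
- have [r [h [Hh ->]]] := minorsM Hf Hg.
  by exists r, h; split.
have [r [h [Hh E]]] := minorsM Hf Hg2.
(* The extra term r D C^(n+1) is harmless: C^(n+1) lies in [sat n.+1], and multiplication by D
   raises the index by 2. *)
have -> : f * (D * g1 + C ^+ n.+1 * g2)
   = D * (f * g1) + (C ^+ n.+2 * h + r * (D * C ^+ n.+1)).
  by rewrite mulrDr [f * (C ^+ n.+1 * _)]mulrCA E [C ^+ n.+2]exprS; ring.
apply: satD; first by apply: sat_delta; exact: IH.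
apply: satD; first exact: sat_minorCX_mul.
by apply: satMl; apply: sat_delta; exact: sat_minorCX.
Qed.

(** * Comparison of [sat] with the ordinary powers *)

Lemma ideal_pow_sub_sat n : ideal_pow p n `<=` sat n.
Proof.
apply: ideal_pow_min; [exact: sat0|exact: satD|] => r a Ia; apply: satMl.
elim: n a Ia => // n IH a Ia; rewrite big_ord_recl.
by apply: sat_mul => //; exact: IH.
Qed.

Lemma delta2 : ideal_pow p 3 (D ^+ 2).
Proof.
have -> : D ^+ 2 = 3 * V * (A * (B * C)) + - V * (B * (B * B))
    + - V ^+ 2 * (C * (C * C)) + - 1 * (A * (A * A)).
  by rewrite /D /A /B /C /w /V; ring.
have P3 r f g h : p f -> p g -> p h -> ideal_pow p 3 (r * (f * (g * h))).
  move=> Hf Hg Hh; apply: ideal_powMl; do 2!apply: ideal_powS => //.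
  exact: ideal_pow1.
have pA := minors_A; have pB := minors_B; have pC := minors_C.
by apply: ideal_powD (P3 _ _ _ _ pA pA pA); do 2?apply: ideal_powD; apply: P3.
Qed.

Lemma minorCX_pow n h : p h -> ideal_pow p n.+1 (C ^+ n * h).
Proof.
move=> Hh; rewrite mulrC; apply: ideal_powS => //.
by have := ideal_powX n (ideal_pow1 minors_C); rewrite mul1n.
Qed.

(** Unfolding the recursion twice gives D^2 g1 + D C^(n+1) g2 + C^(n+3) h. Since D^2 lies in p^3,
    four steps of n gain three in the exponent; the other two terms lie in p^(n+3) and p^(n+4). *)
Lemma sat_sub_ideal_pow n r : (4 * r <= 3 * n + 1)%N -> sat n `<=` ideal_pow p r.
Proof.
have [q] := ubnP n; elim: q n r => // q IH [|[|[|[|n]]]] r /= nq le f Hf.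
- have -> : r = 0%N by clear -le; lia.
  exact: ideal_pow0.
- by apply: (@ideal_pow_le _ _ r 1); [lia|exact: ideal_pow1].
- apply: (@ideal_pow_le _ _ r 1); first by lia.
  have [g [h [_ Hh ->]]] := Hf; rewrite [D * g]mulrC.
  by apply: ideal_pow1; apply: minorsD; apply: minorsMl => //; exact: minors_delta.
- apply: (@ideal_pow_le _ _ r 2); first by lia.
  have [g [h [Hg Hh ->]]] := Hf; apply: ideal_powD.
    by apply: ideal_powS; [exact: minors_delta|exact: ideal_pow1].
  by apply: ideal_pow_le (minorCX_pow 2 Hh).
have [g [h [[g1 [g2 [Hg1 Hg2 ->]]] Hh ->]]] := Hf.
have -> : D * (D * g1 + C ^+ n.+1 * g2) = D ^+ 2 * g1 + D * (C ^+ n.+1 * g2) by ring.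
apply: ideal_powD; first apply: ideal_powD.
(* The subtraction is truncated, so r <= 3 + (r - 3) also covers r < 3. *)
- apply: (@ideal_pow_le _ _ r (3 + (r - 3))); first by lia.
  apply: ideal_powM; first exact: delta2.
  by apply: IH Hg1; lia.
- apply: (@ideal_pow_le _ _ r n.+3); first by lia.
  by apply: ideal_powS; [exact: minors_delta|exact: minorCX_pow].
by apply: ideal_pow_le (minorCX_pow n.+3 Hh); lia.
Qed.

(** * Saturation of [sat] with respect to x, for a regular sequence x, y, z and a saturated p *)

Hypotheses (x_neq0 : x != 0)
  (reg_y : forall f g, y * f = x * g -> exists g', f = x * g')
  (reg_z : forall f a b, z * f = x * a + y * b -> exists a' b', f = x * a' + y * b')
  (minors_x : forall f, p (x * f) -> p f).

(** Induction on q: [reg_z] gives f = x a1 + y b1, then a factor y cancels modulo x by [reg_y],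
    which leaves the same problem for [b1] with one power of y less. *)
Lemma reg_z_pow q f a b :
  z * f = x * a + y ^+ q * b -> exists a' b', f = x * a' + y ^+ q * b'.
Proof.
elim: q f a b => [|q IH] f a b E; first by exists 0, f; ring.
have [|a1 [b1 E1]] := @reg_z f a (y ^+ q * b); first by rewrite E exprS; ring.
have [|c Ec] := @reg_y (z * b1 - y ^+ q * b) (a - z * a1).
  apply: (@subIr _ (z * x * a1)).
  transitivity (z * f - y ^+ q.+1 * b - 2 * (z * x * a1)).
    by rewrite E1 exprS; ring.
  by rewrite E; ring.
have [|a2 [b2 E2]] := IH b1 c b; first by rewrite -Ec; ring.
by exists (a1 + y * a2), b2; rewrite E1 E2 exprS; ring.
Qed.

Lemma minorCX_mod n : exists e, C ^+ n = (-1) ^+ n * y ^+ (2 * n) + x * e.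
Proof.
elim: n => [|n [e E]]; first by exists 0; ring.
exists ((-1) ^+ n * y ^+ (2 * n) * z + e * C).
by rewrite exprS E mulnS exprD exprS /C; ring.
Qed.

(** Modulo x the minor C is - y^2, so [reg_y] is applied twice. *)
Lemma minorC_reg f g : C * f = x * g -> exists g', f = x * g'.
Proof.
move=> E; have [|a Ea] := @reg_y (y * f) (z * f - g).
  by rewrite mulrBr -E /C; ring.
exact: reg_y Ea.
Qed.

Lemma minorCX_reg n f g : C ^+ n * f = x * g -> exists g', f = x * g'.
Proof.
elim: n f g => [|n IH] f g; first by rewrite mul1r => ->; exists g.
by rewrite exprS -mulrA => /minorC_reg[g' /IH].
Qed.

(* Modulo [x] the elements [delta], [C], [A], [B] become [z^3], [-y^2], [-z^2],
   [yz], which forces [g] into [(x, y^(2n+2))]. *)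
Lemma sat_x n f : sat n (x * f) -> sat n f.
Proof.
elim/nat_ind2: n f => // n IH _ f [g [h [Hg Hh E]]].
have [e1 E1] := minorCX_mod n.+1.
have [a [b Eg]] : exists a b, g = x * a + y ^+ (2 * n.+1) * b.
  (* Here D = z^3 + x d; the three factors z are then cancelled one by one modulo (x, y^(2n+2)). *)
  pose d := - 3 * (y * z * V) + w ^+ 2 + v * y ^+ 3.
  have [|a [b Ea]] := @reg_z_pow (2 * n.+1) (z ^+ 2 * g) (f - d * g - e1 * h)
      (- (-1) ^+ n.+1 * h).
    rewrite -[x * (f - _ - _)]addr0 mulrBr mulrBr E E1 /D /d /w /V; ring.
  have [|a' [b' Ea']] := @reg_z_pow (2 * n.+1) (z * g) a b.
    by rewrite -Ea; ring.
  exact: reg_z_pow Ea'.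
have [e E0] := minorCX_mod n.
pose s : R := (-1) ^+ n * b.
have s2 : (-1) ^+ n * s = b by rewrite /s mulrA -exprMn mulrNN mulr1 expr1n mul1r.
(* The factor y^(2n) is traded for (-1)^n C^n modulo x, because C^n already lies in [sat n]. *)
have {}Eg : g = x * (a - e * y ^+ 2 * s) + C ^+ n * (y ^+ 2 * s).
  by rewrite Eg E0 -{1}s2 mulnS exprD; ring.
move: (a - _) Eg => g' Eg.
have Hg' : sat n g'.
  apply: IH; rewrite (_ : x * g' = g + - (y ^+ 2 * s) * C ^+ n); last by rewrite Eg; ring.
  by apply: satD => //; apply: satMl; exact: sat_minorCX.
(* Rests on y^2 D = x A^2 + C (y V C + z A): up to a multiple of C^(n+1), the term D C^n y^2 s
   becomes x s A^2 C^n, and A^2 C^n lies in [sat n.+2]. *)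
have E' : x * (f - D * g' - s * (A * (A * C ^+ n)))
    = C ^+ n.+1 * (s * (y * V * C + z * A) + h).
  rewrite !mulrBr E Eg [C ^+ n.+1]exprS; move: (C ^+ n) => cn.
  by rewrite /D /A /w /V /C; ring.
have [h' Eh'] := minorCX_reg (esym E').
have Hh' : p h'.
  apply: minors_x; rewrite -Eh'; apply: minorsD => //; apply: minorsMl.
  by apply: minorsD; apply: minorsMl; [exact: minors_C|exact: minors_A].
have Ef : f - D * g' - s * (A * (A * C ^+ n)) = C ^+ n.+1 * h'.
  by apply: (mulfI x_neq0); rewrite E' Eh'; ring.
rewrite -[f](subrK (D * g')) -[f - _](subrK (s * (A * (A * C ^+ n)))) Ef.
apply: satD; last exact: sat_delta.
apply: satD; first exact: sat_minorCX_mul.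
apply: satMl; do 2![apply: sat_mul; first exact: minors_A].
exact: sat_minorCX.
Qed.

End Determinantal.

(** * Divisibility, separatedness and completeness with respect to a variable *)

Section PowerSeries.
Context (n : nat) (R : comNzRingType).
Implicit Types (f g : {fps R[n]}) (i j : 'I_n) (u v : 'X_{1..n}).

Lemma fps_coef0 u : fps_coef (0 : {fps R[n]}) u = 0.
Proof. by []. Qed.

Lemma fps_coef_varM i f u : fps_coef (fps_var i * f) u =
  if u i == 0%N then 0 else fps_coef f (u - U_(i))%MM.
Proof.
rewrite fps_coefM; case: eqP => [u0|/eqP u0].
  rewrite big1 // => -[a b] /= /eqP E; case: eqP => [Ea|]; last by rewrite mul0r.
  by move/(congr1 (fun c : 'X_{1..n} => c i)): E; rewrite u0 Ea mnmDE mnm1E eqxx.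
have le : (U_(i) <= u)%MM by rewrite lep1mP.
have hi : (mdeg (U_(i) : 'X_{1..n}) < (mdeg u).+1)%N by 
  by rewrite ltnS mdeg1 lt0n mdeg_eq0; apply: contraNneq u0 => ->; rewrite mnm0E.
have hu : (mdeg (u - U_(i))%MM < (mdeg u).+1)%N.
  by rewrite ltnS -{2}(submK le) mdegD leq_addr.
rewrite (bigD1 (BMultinom hi, BMultinom hu)) /=; last by rewrite addmC submK.
rewrite eqxx mul1r big1 ?addr0 // => -[a b] /= /andP[/eqP E ne].
case: eqP => [Ea|]; last by rewrite mul0r.
case/negP: ne; apply/eqP; congr pair; apply/val_inj; first exact: Ea.
move/(congr1 (fun c => c - U_(i))%MM): E.
by rewrite Ea [(U_(i) + _)%MM]addmC addmK => /esym.
Qed.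

Lemma fps_coef_varXM i d f u : fps_coef (fps_var i ^+ d * f) u =
  if (u i < d)%N then 0 else fps_coef f (u - U_(i) *+ d)%MM.
Proof.
elim: d f u => [|d IH] f u; first by rewrite mul1r ltn0 mulm0n subm0.
rewrite exprS -mulrA fps_coef_varM; case: eqP => [->//|/eqP u0].
rewrite IH mnmBE mnm1E eqxx submDA -mulmS (_ : (u i - true < d)%N = (u i < d.+1)%N) //.
by move: u0; clear; lia.
Qed.

Definition fps_quo i f : {fps R[n]} := FPS (fun u => fps_coef f (u + U_(i))%MM).
Definition fps_rem i f : {fps R[n]} :=
  FPS (fun u => if u i == 0%N then fps_coef f u else 0).

Lemma fps_varE i f : f = fps_var i * fps_quo i f + fps_rem i f.
Proof.
apply: fpsP => u; rewrite fps_coefD fps_coef_varM /=.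
case: eqP => [|/eqP u0]; first by rewrite add0r.
by rewrite submK ?addr0 // lep1mP.
Qed.

Lemma fps_var_dvdP i f : (forall u, u i = 0%N -> fps_coef f u = 0) ->
  exists g, f = fps_var i * g.
Proof.
move=> H; exists (fps_quo i f); rewrite {1}(fps_varE i f) -[RHS]addr0.
congr (_ + _); apply: fpsP => u /=.
by case: eqP => // /H.
Qed.

Lemma fps_var_reg i j f g : i != j -> fps_var j * f = fps_var i * g ->
  exists f', f = fps_var i * f'.
Proof.
move=> ij E; apply: fps_var_dvdP => u u0.
have : fps_coef (fps_var j * f) (u + U_(j))%MM = fps_coef (fps_var i * g) (u + U_(j))%MM.
  by rewrite E.
rewrite !fps_coef_varM !mnmDE !mnm1E eqxx (eq_sym j) (negbTE ij) u0 addn1 /=.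
by rewrite addmK.
Qed.

Lemma fps_var2_reg i j l f a b : i != l -> j != l ->
  fps_var l * f = fps_var i * a + fps_var j * b ->
  exists a' b', f = fps_var i * a' + fps_var j * b'.
Proof.
move=> il jl E; exists (fps_quo i f).
have [|b' Eb] := @fps_var_dvdP j (fps_rem i f).
  move=> u uj /=; case: eqP => // ui.
  have : fps_coef (fps_var l * f) (u + U_(l))%MM
    = fps_coef (fps_var i * a + fps_var j * b) (u + U_(l))%MM by rewrite E.
  rewrite fps_coefD !fps_coef_varM !mnmDE !mnm1E eqxx !(eq_sym l).
  by rewrite (negbTE il) (negbTE jl) ui uj addn1 /= addmK addr0.
by exists b'; rewrite -Eb -fps_varE.
Qed.

(** Each [f q] is divisible by every power of the variable. Identities between infinite sums are
    obtained by taking for [f q] the defect of the q-th tails. *)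
Lemma fps_var_separated i (f : nat -> {fps R[n]}) :
  (forall q, f q = fps_var i * f q.+1) -> forall q, f q = 0.
Proof.
move=> E q; apply: fpsP => u; rewrite fps_coef0.
have [d] := ubnP (u i); elim: d q u => // d IH q u ud.
rewrite E fps_coef_varM; case: eqP => // /eqP u0; apply: IH.
by rewrite mnmBE mnm1E eqxx; lia.
Qed.

(* [s q] is the sum of the [fps_var i ^+ j * a (q + j)] over all [j]. *)
Lemma fps_var_complete i (a : nat -> {fps R[n]}) :
  exists s, forall q, s q = a q + fps_var i * s q.+1.
Proof.
exists (fun q => FPS (fun u => \sum_(j < (u i).+1)
  fps_coef (a (q + j)%N) (u - U_(i) *+ j)%MM)).
move=> q; apply: fpsP => u; rewrite fps_coefD fps_coef_varM /=.
rewrite big_ord_recl addn0 mulm0n subm0; congr (_ + _).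
case: eqP => [->|/eqP u0]; first by rewrite big_ord0.
rewrite mnmBE mnm1E eqxx subn1 prednK ?lt0n //.
by apply: eq_bigr => j _; rewrite /= addnS submDA mulmS.
Qed.

Lemma fps_var_neq0 i : fps_var i != 0 :> {fps R[n]}.
Proof.
apply/eqP => /(congr1 (fun f => fps_coef f U_(i)%MM)) /= /eqP.
by rewrite eqxx oner_eq0.
Qed.

End PowerSeries.

(** Geometric series: with r = - g / c, the inverse is the sum of the terms c^(-1) r^j times the
    j-th power of the variable. *)
Lemma fps_unit_const (n : nat) (F : fieldType) (i : 'I_n) (c : F) (g : {fps F[n]}) :
  c != 0 -> exists h, (c *: 1 + fps_var i * g) * h = 1.
Proof.
move=> c0; pose r := - (c^-1 *: g).
have [s Es] := fps_var_complete i (fun q => c^-1 *: r ^+ q).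
exists (s 0%N); apply/eqP; rewrite -subr_eq0; apply/eqP.
have -> : c *: 1 + fps_var i * g = c%:A * (1 - fps_var i * r).
  by rewrite mulr_algl scalerBr scalerAr /r scalerN scalerA divff // scale1r mulrN opprK.
clearbody r; pose G q := c%:A * (1 - fps_var i * r) * s q - r ^+ q.
apply: (@fps_var_separated _ _ i G _ 0%N) => q.
have cV : c%:A * c^-1%:A = 1 :> {fps F[n]} by rewrite mulr_algl scalerA divff // scale1r.
by rewrite /G Es -[c^-1 *: _]mulr_algl exprS; ring: cV.
Qed.

(** * Order of a series in one variable *)

Section OneVariable.
Context (R : comNzRingType).

Local Notation t := (fps_var ord0 : {fps R[1]}).
Local Notation deg d := (U_(ord0) *+ d)%MM.

Lemma fps1_coef_varXM d e (f : {fps R[1]}) : fps_coef (t ^+ e * f) (deg d) =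
  if (d < e)%N then 0 else fps_coef f (deg (d - e)).
Proof.
rewrite fps_coef_varXM mulmnE mnm1E mul1n; case: ifP => // _; congr fps_coef.
by apply/mnmP => i; rewrite mnmBE !mulmnE mulnBr.
Qed.

Lemma fps1_coef_varX d e : fps_coef (t ^+ e) (deg d) = (d == e)%:R.
Proof.
rewrite -[t ^+ e]mulr1 fps1_coef_varXM fps_coef1; case: ltnP => [lt|le].
  by rewrite ltn_eqF.
congr (nat_of_bool _)%:R; apply/eqP/eqP => [/mnmP /(_ ord0)|->].
  rewrite mulmnE mnm1E mnm0E mul1n => /eqP; rewrite subn_eq0 => le'.
  by apply/eqP; rewrite eqn_leq le'.
by rewrite subnn mulm0n.
Qed.

Lemma fps1_varE (f : {fps R[1]}) : exists g, f = fps_coef f 0%MM *: 1 + t * g.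
Proof.
exists (fps_quo ord0 f); rewrite {1}(fps_varE ord0 f) addrC; congr (_ + _).
apply: fpsP => u; rewrite fps_coefZ fps_coef1 /= -mdeg_eq0 mdegE big_ord1.
case: eqP => [u0|_]; last by rewrite mulr0.
by rewrite mulr1; congr fps_coef; apply/mnmP => i; rewrite ord1 u0 mnm0E.
Qed.

End OneVariable.

(** Otherwise every power of t would divide f, and all its coefficients would vanish. *)
Lemma fps1_factor (F : fieldType) (f : {fps F[1]}) : f != 0 ->
  exists d c g, c != 0 /\ f = fps_var ord0 ^+ d * (c *: 1 + fps_var ord0 * g).
Proof.
move=> f0; apply: contrapT => H; move/eqP: f0; apply.
have step d : exists g, f = fps_var ord0 ^+ d * g.
  elim: d => [|d [g E]]; first by exists f; rewrite mul1r.
  have [h Eh] := fps1_varE g.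
  have [c0|c0] := eqVneq (fps_coef g 0%MM) 0.
    by exists h; rewrite E Eh c0 scale0r add0r mulrA -exprSr.
  by case: H; exists d, (fps_coef g 0%MM), h; rewrite -Eh.
apply: fpsP => u; have [g ->] := step (u ord0).+1.
by rewrite fps_coef_varXM ltnSn.
Qed.

(** * Decomposition of series in three variables *)

Definition var_x : 'I_3 := ord0.
Definition var_y : 'I_3 := Ordinal (isT : (1 < 3)%N).
Definition var_z : 'I_3 := Ordinal (isT : (2 < 3)%N).

Lemma fps3_varE (R : comNzRingType) (f : {fps R[3]}) : exists c f1 f2 f3,
  f = c *: 1 + fps_var var_x * f1 + fps_var var_y * f2 + fps_var var_z * f3.
Proof.
pose r := fps_rem var_z (fps_rem var_y (fps_rem var_x f)).
have -> : f = fps_var var_x * fps_quo var_x f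
    + fps_var var_y * fps_quo var_y (fps_rem var_x f)
    + fps_var var_z * fps_quo var_z (fps_rem var_y (fps_rem var_x f)) + r.
  by rewrite -addrA -fps_varE -addrA -fps_varE -fps_varE.
suff -> : r = fps_coef f 0%MM *: 1 by do 4!eexists; rewrite addrC !addrA.
apply: fpsP => u; rewrite fps_coefZ fps_coef1 /=.
case: (u =P 0%MM) => [->|ne]; first by rewrite !mnm0E eqxx mulr1.
do 3!(case: eqP => [?|_]; last by rewrite mulr0).
case: ne; apply/mnmP => -[[|[|[|i]]] hi] //; rewrite mnm0E.
- by rewrite (_ : Ordinal hi = var_x) //; apply/val_inj.
- by rewrite (_ : Ordinal hi = var_y) //; apply/val_inj.
- by rewrite (_ : Ordinal hi = var_z) //; apply/val_inj.
Qed.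

Local Notation "a %:F" := (@FracField.tofrac _ a).

(** Clearing denominators: s is the product of the denominators of all terms, and it stays outside p
    by primality. *)
Lemma symbolic_powP (R : idomainType) (p : set R) n f : p 0 -> ~ p 1 ->
  (forall a b, ~ p a -> ~ p b -> ~ p (a * b)) ->
  symbolic_pow p n f -> exists s, ~ p s /\ ideal_pow p n (s * f).
Proof.
move=> p0 p1 pM [e [He Ef]].
suff [s [b [ps Ib Es]]] : exists s b, [/\ ~ p s, ideal_pow p n b
    & s%:F * \sum_(y <- e) y.1 * y.2 = b%:F].
  exists s; split=> //; move: Es; rewrite -Ef -tofracM => /eqP.
  by rewrite tofrac_eq => /eqP ->.
elim: e He {f Ef} => [|[y1 y2] e IH] He.
  by exists 1, 0; split=> //; [exact: ideal_pow0l|rewrite big_nil mulr0 tofrac0].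
have [|s [b [ps Ib Es]]] := IH; first by move=> w we; apply: He; rewrite inE we orbT.
have [[a [s' [ps' /= ->]]] [b' Ib' /= <-]] := He _ (mem_head _ _).
exists (s' * s), (s * a * b' + s' * b); split; first exact: pM.
  by apply: ideal_powD; apply: ideal_powMl.
have s'0 : s'%:F != 0 by rewrite tofrac_eq0; apply: contra_notN ps' => /eqP ->.
rewrite big_cons mulrDr !tofracD !tofracM -[X in _ + X]mulrA Es /=; congr (_ + _).
rewrite mulrACA mulrA.
rewrite ![s'%:F * _]mulrC -!mulrA.
by rewrite mulKf // mulrCA.
Qed.

(** * Equations of the curve: the kernel of [phi] is generated by the minors *)

Section Curve.
Context (k : fieldType) (m : nat).
Hypotheses (m_ge1 : (1 <= m)%N) (coprime_3m : coprime 3 m).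

Local Notation x := (fps_var var_x : {fps k[3]}).
Local Notation y := (fps_var var_y : {fps k[3]}).
Local Notation z := (fps_var var_z : {fps k[3]}).
Local Notation v := (x ^+ m.-1).
Local Notation A := (minorA x y z v).
Local Notation B := (minorB x y z v).
Local Notation C := (minorC x y z).
Local Notation p := (minors x y z v).
Local Notation D := (delta x y z v).
Local Notation phi := (curve_map k m).
Local Notation t := (fps_var ord0 : {fps k[1]}).
Local Notation deg d := (U_(ord0) *+ d)%MM.

(** The monomial x^a y^b z^c maps to a single power of t, with exponent 3a + (3+m)b + (3+2m)c. *)
Lemma coef_curve_map_eq0 f d :
  (forall a b c, d <> 3 * a + (3 + m) * b + (3 + 2 * m) * c)%N ->
  fps_coef (phi f) (deg d) = 0.
Proof.
move=> H; rewrite /curve_map /fps_subst /= fps_coef_sum big1 // => u _.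
move: (u : 'X_{1..3}) => {}u; rewrite fps_coefZ; under eq_bigr do rewrite -exprM.
rewrite prodrXr fps1_coef_varX !big_ord_recl big_ord0.
case: eqP => [E|]; last by rewrite mulr0.
case: (H (u var_x) (u var_y) (u var_z)); rewrite E.
have -> : lift ord0 (ord0 : 'I_2) = var_y by apply/val_inj.
have -> : lift ord0 (lift ord0 (ord0 : 'I_1)) = var_z by apply/val_inj.
by rewrite /= mul0n mul1n !addn0 addnA.
Qed.

Lemma curve_map_scale1 (c : k) : phi (c *: 1) = c *: 1.
Proof. by rewrite linearZ rmorph1. Qed.

(** Under [phi] the row (y, z, w) becomes t^m times the row (x, y, z). *)
Lemma curve_map_minors f : p f -> phi f = 0.
Proof.
have phi_xv : phi x * phi v = (t ^+ m) ^+ 3.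
  by rewrite -rmorphM -exprS prednK // rmorphXn /= curve_map_var mul0n addn0 exprAC.
have [phi_x phi_y phi_z] : [/\ phi x = t ^+ 3, phi y = t ^+ 3 * t ^+ m
    & phi z = t ^+ 3 * (t ^+ m) ^+ 2].
  by split; rewrite curve_map_var /= ?(mul0n, mul1n, addn0) // exprD // (mulnC 2) exprM.
move: v phi_xv => v' phi_xv [a [b [c ->]]].
rewrite /minorA /minorB /minorC !(rmorphD, rmorphN, rmorphXn, rmorphM) /=.
by rewrite phi_xv phi_x phi_y phi_z; ring.
Qed.

(* [m] and [2m] are gaps of the semigroup generated by [3], [3+m], [3+2m]. *)
Lemma minors_peel f g : phi f = t ^+ (2 * m + 4) * g ->
  exists f1 h, p h /\ f = x * f1 + h.
Proof.
move=> Ef.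
have [c [f1 [f2 [f3 E1]]]] := fps3_varE f.
have [b [f21 [f22 [f23 E2]]]] := fps3_varE f2.
have [e [f31 [f32 [f33 E3]]]] := fps3_varE f3.
(* Modulo p the products y^2, yz and z^2 are xz, xw and yw, all multiples of x. Hence f reduces to c
   + b y + e z modulo x and p. *)
pose h := - f33 * A + (f23 + f32) * B - f22 * C.
have ph : p h by exists (- f33), (f23 + f32), (- f22); rewrite /h [- f22 * C]mulNr.
pose F := f1 + y * f21 + z * f31 + z * f22 + x * (x * v) * (f23 + f32)
  + x * v * y * f33.
have E : f = c *: 1 + (b *: 1) * y + (e *: 1) * z + x * F + h.
  rewrite E1 E2 E3 /F /h /minorA /minorB /minorC.
  move: (c *: 1) (b *: 1) (e *: 1) v => c' b' e' v'; ring.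
clearbody h F.
have Ephi : phi f = c *: t ^+ 0 + b *: t ^+ (3 + m) + e *: t ^+ (3 + 2 * m)
    + t ^+ 3 * phi F.
  rewrite E !(rmorphD, rmorphM) /= (curve_map_minors ph) addr0 !curve_map_scale1.
  by rewrite !curve_map_var /= mul0n addn0 mul1n -!scalerAl !mul1r.
(* The bound exceeds 3 + 2m, the exponent of [phi z], by one, so the coefficients at 0, 3 + m and 3
   + 2m, which detect c, b and e, are all covered. *)
have K d : (d < 2 * m + 4)%N ->
    c * (d == 0)%:R + b * (d == 3 + m)%:R + e * (d == 3 + 2 * m)%:R
    + (if (d < 3)%N then 0 else fps_coef (phi F) (deg (d - 3))) = 0.
  move=> lt; have := fps1_coef_varXM d (2 * m + 4) g.
  rewrite lt -Ef Ephi !fps_coefD !fps_coefZ !fps1_coef_varX.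
  by rewrite fps1_coef_varXM.
have c0 : c = 0.
  by have := K 0%N; rewrite !mulr0 mulr1 !addr0; apply; lia.
have gap1 : fps_coef (phi F) (deg m) = 0.
  apply: coef_curve_map_eq0 => i [|j] [|l]; rewrite ?mulnS; last by lia.
  - move=> Em; move: coprime_3m.
    by rewrite Em !muln0 !addn0 /coprime gcdnMr.
  - by lia.
  - by lia.
have {}K d : (3 + d < 2 * m + 4)%N ->
    b * (d == m)%:R + e * (d == 2 * m)%:R + fps_coef (phi F) (deg d) = 0.
  move=> /K; rewrite c0 mul0r add0r !eqn_add2l addKn.
  by rewrite (_ : (3 + d < 3)%N = false) // ltnNge leq_addr.
have b0 : b = 0.
  have := K m; rewrite eqxx mulr1 gap1 addr0 ltn_eqF ?mulr0 ?addr0; last by lia.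
  by apply; lia.
have gap2 : fps_coef (phi F) (deg (2 * m)) = 0.
  apply: coef_curve_map_eq0 => i j l Em; move: coprime_3m.
  suff [n ->] : exists n, (m = n * 3)%N by rewrite /coprime gcdnMl.
  (* If 2m = 3i then m = 3(m - i); if 2m = 3i + (3 + m) then m = 3(i + 1). Other combinations are
     too large. *)
  case: j Em => [|[|j]]; case: l => [|l]; rewrite ?mulnS => Em; try by lia.
    by exists (m - i)%N; lia.
  by exists i.+1; lia.
have e0 : e = 0.
  by have := K (2 * m)%N; rewrite b0 mul0r add0r eqxx mulr1 gap2 addr0; apply; lia.
by exists F, h; split=> //; rewrite E c0 b0 e0 !scale0r !mul0r !add0r.
Qed.

(** By [minors_peel], f is x f1 plus an element of p, and f1 is again in the kernel. Iterating, the
    coefficients of A, B and C sum to x-adically convergent series. *)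
Lemma curve_map_eq0_minors f : phi f = 0 -> p f.
Proof.
move=> f0.
(* The quadruple holds the quotient f1 and the coefficients of A, B, C; zeros serve as default
   values outside the kernel. *)
have [|next nextP] := @choice {fps k[3]}
    ({fps k[3]} * {fps k[3]} * {fps k[3]} * {fps k[3]})
    (fun g q => phi g = 0 -> phi q.1.1.1 = 0 /\
      g = x * q.1.1.1 + (q.1.1.2 * A + q.1.2 * B + q.2 * C)).
  move=> g; have [g0|] := pselect (phi g = 0); last by exists (0, 0, 0, 0).
  have [|g1 [h [ph Eg]]] := @minors_peel g 0; first by rewrite mulr0.
  have ph' := ph; move: ph' => [a [b [c Eh]]]; exists (g1, a, b, c) => _ /=.
  rewrite -Eh -Eg; split=> //; apply: (mulfI (_ : phi x != 0)).
    by rewrite curve_map_var expf_neq0 // fps_var_neq0.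
  by rewrite mulr0 -rmorphM -g0 Eg rmorphD /= (curve_map_minors ph) addr0.
pose s q := iter q (fun g => (next g).1.1.1) f.
have s0 q : phi (s q) = 0 by elim: q => //= q /nextP[].
have [a Ea] := fps_var_complete var_x (fun q => (next (s q)).1.1.2).
have [b Eb] := fps_var_complete var_x (fun q => (next (s q)).1.2).
have [c Ec] := fps_var_complete var_x (fun q => (next (s q)).2).
exists (a 0%N), (b 0%N), (c 0%N); apply/eqP; rewrite -subr_eq0; apply/eqP.
(* [F q] is the defect of the q-th tails, and F q = x F (q+1). *)
pose F q := s q - (a q * A + b q * B + c q * C).
apply: (@fps_var_separated _ _ var_x F _ 0%N) => q.
rewrite /F Ea Eb Ec {1}(proj2 (nextP _ (s0 q))) -[s q.+1]/(next (s q)).1.1.1.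
by move: (next _) => [[[? ?] ?] ?] /=; ring.
Qed.

Lemma curve_idealE : curve_ideal k m = p.
Proof.
by apply/seteqP; split=> f; [exact: curve_map_eq0_minors|exact: curve_map_minors].
Qed.

(** * Cancellation of elements outside p, and the symbolic powers *)

Lemma curve_map_x : phi x = t ^+ 3.
Proof. by rewrite curve_map_var /= mul0n addn0. Qed.

Lemma curve_map_x_neq0 : phi x != 0.
Proof. by rewrite curve_map_x expf_neq0 // fps_var_neq0. Qed.

(** Each peeling lowers the order by 3, and the last one needs order 2m + 4 = 3 + (2m + 1). *)
Lemma minors_peel_iter n f g : phi f = t ^+ (3 * n + (2 * m + 1)) * g ->
  exists f' h, p h /\ f = x ^+ n * f' + h.
Proof.
elim: n f => [|n IH] f Ef.
  by exists f, 0; rewrite mul1r addr0; split=> //; exists 0, 0, 0; rewrite !mul0r !addr0.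
have [|f1 [h [ph Eh]]] := @minors_peel f (t ^+ (3 * n) * g).
  by rewrite Ef mulrA -exprD; congr (_ ^+ _ * _); clear; lia.
have [|f2 [h' [ph' Eh']]] := IH f1.
  apply: (mulfI curve_map_x_neq0).
  rewrite -rmorphM -[LHS]addr0 -(curve_map_minors ph) -rmorphD /= -Eh Ef curve_map_x.
  by rewrite mulrA -exprD; congr (_ ^+ _ * _); clear; lia.
exists f2, (x * h' + h); split; first by apply: minorsD => //; exact: minorsMl.
by rewrite Eh Eh' exprS; ring.
Qed.

(* With [phi s = t^d (c + t g)], [c != 0], the difference [r] of [s^3] and
   [c^3 x^d] has order greater than [3d]; hence [r^q] lies in [p + x^(dq+1) R]
   for large [q], whereas [s] divides [(c^3 x^d)^q - (-r)^q]. *)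
Lemma varX_mod_minors s : ~ p s -> exists N a h, p h /\ x ^+ N = s * a + h.
Proof.
move=> ps.
have /fps1_factor[d [c [g [c0 Es]]]] : phi s != 0.
  by apply/eqP => /curve_map_eq0_minors.
(* This q gives (3d + 1) q = 3 (dq + 1) + (2m + 1), the order needed to peel r^q exactly dq + 1
   times. Below, [g'] is ((c + t g)^3 - c^3) / t. *)
pose q := (2 * m + 4)%N; pose c' := c ^+ 3; pose r := s ^+ 3 - c' *: 1 * x ^+ d.
pose g' := g * (3 * (c *: 1) ^+ 2 + 3 * (c *: 1) * t * g + t ^+ 2 * g ^+ 2).
have Er : phi r = t ^+ (3 * d + 1) * g'.
  have -> : phi r = phi s ^+ 3 - c' *: 1 * phi x ^+ d.
    by rewrite -(curve_map_scale1 c') -!rmorphXn -rmorphM -rmorphB.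
  have -> : c' *: 1 = (c *: 1) ^+ 3 :> {fps k[1]} by rewrite exprZn expr1n.
  rewrite curve_map_x Es exprD exprM exprAC /g'.
  move: (c *: 1) (t ^+ d) => c1 td; ring.
have [|g3 [h [ph Eh]]] := @minors_peel_iter (d * q).+1 (r ^+ q) (g' ^+ q).
  rewrite rmorphXn /= Er exprMn -exprM; congr (_ ^+ _ * _); rewrite /q; lia.
(* Inverts the factor that multiplies x^(dq) in X^q - (-r)^q, up to the term in h. *)
have [u Eu] := @fps_unit_const 3 k var_x (c' ^+ q) (- ((-1) ^+ q * g3))
  (expf_neq0 _ (expf_neq0 _ c0)).
exists (d * q)%N.
pose X := c' *: 1 * x ^+ d.
exists (u * s ^+ 2 * (\sum_(i < q) X ^+ (q.-1 - i) * (- r) ^+ i)).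
exists (u * (-1) ^+ q * h); split; first exact: minorsMl.
set S := \sum_(_ < _) _.
have ES : s ^+ 3 * S = X ^+ q - (- r) ^+ q by rewrite subrXX opprK addrC subrK.
have EX : X ^+ q = c' ^+ q *: 1 * x ^+ (d * q).
  by rewrite /X [LHS]exprMn exprZn expr1n -[x ^+ d ^+ q]exprM.
move: ES; rewrite EX [(- r) ^+ q]exprNn Eh [x ^+ (d * q).+1]exprSr => ES.
transitivity (u * (s ^+ 3 * S + (-1) ^+ q * h)); last by ring.
rewrite ES -[LHS]mul1r -[in LHS]Eu.
by move: (c' ^+ q *: 1) ((-1) ^+ q) (x ^+ (d * q)) => c1 e1 xd; ring.
Qed.

Lemma minors_varX f : p (x * f) -> p f.
Proof.
move=> /curve_map_minors; rewrite rmorphM => /eqP.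
rewrite mulf_eq0 (negbTE curve_map_x_neq0) /= => /eqP.
exact: curve_map_eq0_minors.
Qed.

Lemma sat_varX n f : sat x y z v n (x * f) -> sat x y z v n f.
Proof.
apply: sat_x.
- exact: fps_var_neq0.
- by move=> ? ?; apply: fps_var_reg.
- by move=> ? ? ?; apply: fps_var2_reg.
- exact: minors_varX.
Qed.

(** With x^N = s a + h, the element s divides x^(Nn) - h^n, while h^n lies in p^n, hence in [sat n].
    So x^(Nn) f is in [sat n], and [sat_varX] removes the powers of x. *)
Lemma sat_cancel n s f : ~ p s -> sat x y z v n (s * f) -> sat x y z v n f.
Proof.
move=> /varX_mod_minors[N [a [h [ph E]]]] Hf.
suff : sat x y z v n (x ^+ (N * n) * f).
  by elim: (N * n)%N => [|j IH]; rewrite ?mul1r // exprS -mulrA => /sat_varX.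
have := subrXX (x ^+ N) h n; rewrite (_ : x ^+ N - h = s * a); last by rewrite E addrK.
set S := \sum_(_ < _) _; rewrite -exprM => /(canRL (subrK _)) ->.
rewrite (_ : _ * f = (a * S) * (s * f) + h ^+ n * f); last by ring.
apply: satD; first exact: satMl.
rewrite mulrC; apply: satMl; apply: ideal_pow_sub_sat.
by have := ideal_powX n (ideal_pow1 ph); rewrite mul1n.
Qed.

Lemma curve_ideal_symbolic_sat n :
  symbolic_pow (curve_ideal k m) n `<=` sat x y z v n.
Proof.
rewrite curve_idealE => f Hf; have [|||s [ps Hs]] := symbolic_powP _ _ _ Hf.
- by apply: curve_map_eq0_minors; rewrite rmorph0.
- by move=> /curve_map_minors /eqP; rewrite rmorph1 oner_eq0.
- move=> a b pa pb /curve_map_minors /eqP; rewrite rmorphM mulf_eq0.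
  by case/orP => /eqP /curve_map_eq0_minors.
by apply: sat_cancel ps _; exact: ideal_pow_sub_sat.
Qed.

Lemma curve_symbolic_sub_pow n r : (4 * r <= 3 * n + 1)%N ->
  symbolic_pow (curve_ideal k m) n `<=` ideal_pow (curve_ideal k m) r.
Proof.
move=> le; rewrite [X in ideal_pow X]curve_idealE.
by apply: subset_trans (sat_sub_ideal_pow le); exact: curve_ideal_symbolic_sat.
Qed.

(** The product x D = B^2 - A C lies in p^2, and x, being outside p, becomes invertible in the
    localization. *)
Lemma delta_symbolic q : symbolic_pow (curve_ideal k m) (4 * q) (D ^+ (2 * q)).
Proof.
have ID : ideal_pow p (4 * q) ((x * D) ^+ (2 * q)).
  rewrite (_ : (4 * q = 2 * (2 * q))%N); last by rewrite mulnA.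
  apply: ideal_powX; rewrite (_ : x * D = B * B + (- A) * C).
    apply: ideal_powD; apply: ideal_powS.
    - exact: minors_B.
    - by apply: ideal_pow1; exact: minors_B.
    - by rewrite -mulN1r; apply: minorsMl; exact: minors_A.
    - by apply: ideal_pow1; exact: minors_C.
  by rewrite /delta /minorA /minorB /minorC; move: v => v'; ring.
rewrite /symbolic_pow curve_idealE.
exists [:: (1%:F / (x ^+ (2 * q))%:F, ((x * D) ^+ (2 * q))%:F)]; split.
  move=> w; rewrite inE => /eqP -> /=; split; last by exists ((x * D) ^+ (2 * q)).
  exists 1, (x ^+ (2 * q)); split=> // /curve_map_minors /eqP.
  by rewrite rmorphXn expf_eq0 (negbTE curve_map_x_neq0) andbF.
rewrite big_seq1 /= exprMn tofracM mulrA [1%:F / _ * _]mulrAC tofrac1 mul1r.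
by rewrite divff ?mul1r // tofrac_eq0 expf_neq0 // fps_var_neq0.
Qed.

(** * Orders of vanishing at the origin *)

Lemma vanishesD d (f g : {fps k[3]}) : vanishes d f -> vanishes d g -> vanishes d (f + g).
Proof. by move=> Hf Hg u hu; rewrite fps_coefD Hf ?Hg ?addr0. Qed.

Lemma vanishes_var i : vanishes 1 (fps_var i : {fps k[3]}).
Proof.
move=> u; rewrite ltnS leqn0 mdeg_eq0 => /eqP -> /=.
by rewrite eq_sym -mdeg_eq0 mdeg1.
Qed.

Lemma vanishesMl d (f g : {fps k[3]}) : vanishes d g -> vanishes d (f * g).
Proof. by move=> Hg; apply: (@vanishesM _ _ 0 d). Qed.

Lemma vanishes_var2 i j (f : {fps k[3]}) : vanishes 2 (f * (fps_var i * fps_var j)).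
Proof.
by apply: vanishesMl; apply: (@vanishesM _ _ 1 1); exact: vanishes_var.
Qed.

Lemma minors_vanishes f : p f -> vanishes 2 f.
Proof.
move=> [a [b [c ->]]].
have -> : a * A + b * B + c * C = (a * x * v) * (x * y) + (- a) * (z * z)
    + b * (y * z) + (- b * x * v) * (x * x) + c * (x * z) + (- c) * (y * y).
  by rewrite /minorA /minorB /minorC; move: v => v'; ring.
by repeat apply: vanishesD; exact: vanishes_var2.
Qed.

Lemma ideal_pow_vanishes n f : ideal_pow p n f -> vanishes (n * 2) f.
Proof.
move: f; apply: ideal_pow_min => [u _ //|f g|r a pa]; first exact: vanishesD.
apply: vanishesMl; elim: n a pa => [|n IH] a pa; first by move=> u.
by rewrite big_ord_recl mulSn; apply: vanishesM; [exact: minors_vanishes|exact: IH].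
Qed.

(** Modulo x the power D^n is z^(3n), and multiples of x do not reach this coefficient. *)
Lemma delta_coef n : fps_coef (D ^+ n) (U_(var_z) *+ (3 * n))%MM = 1.
Proof.
have [e ->] : exists e, D ^+ n = z ^+ (3 * n) * 1 + x * e.
  elim: n => [|n [e E]]; first by exists 0; rewrite mulr0 mulr1 addr0.
  exists (e * D + z ^+ (3 * n)
    * (- 3 * (y * z * (x * v)) + (x * (x * v)) ^+ 2 + v * y ^+ 3)).
  by rewrite exprSr E mulnS exprD /delta; move: v => v'; ring.
rewrite fps_coefD fps_coef_varM fps_coef_varXM !mulmnE !mnm1E mul0n eqxx addr0.
rewrite mul1n ltnn fps_coef1 (_ : (_ - _)%MM = 0%MM) ?eqxx //.
by apply/mnmP => i; rewrite mnmBE subnn mnm0E.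
Qed.

Lemma delta_notin_pow q : ~ ideal_pow (curve_ideal k m) (3 * q).+1 (D ^+ (2 * q)).
Proof.
rewrite curve_idealE => /ideal_pow_vanishes H.
have := delta_coef (2 * q); rewrite H; first by move/eqP; rewrite eq_sym oner_eq0.
by rewrite mdegMn mdeg1; lia.
Qed.

End Curve.
Theorem theorem7p7 (K : realType) (k : fieldType) (m : nat)
  (m_ge1 : (1 <= m)%N) (coprime_3m : coprime 3 m) :
  resurgence K (curve_ideal k m) = constructive_ereal.EFin (4 / 3).
Proof.
apply/le_anti/andP; split.
  apply: ereal.ge_ereal_sup => _ [n [r [n1 r1 nsub ->]]].
  rewrite constructive_ereal.lee_fin ler_pdivrMr ?ltr0n //.
  have lt : (3 * n + 1 < 4 * r)%N.
    by rewrite ltnNge; apply/negP => /(curve_symbolic_sub_pow m_ge1 coprime_3m).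
  have : 3 * n%:R <= 4 * r%:R :> K by rewrite -!natrM ler_nat; lia.
  lra.
apply/constructive_ereal.lee_addgt0Pr => e e0.
(* Chosen with 1/q < e: the gap 4/3 - 4q/(3q + 1) equals 4/(9q + 3), which is below 1/q. *)
pose q := (Num.trunc e^-1).+1.
have eq1 : 1 <= e * q%:R.
  by rewrite -ler_pdivrMl // mulr1 ltW // truncnS_gt.
have q0 : 0 < q%:R :> K by rewrite ltr0n.
apply: (@le_trans _ _ (constructive_ereal.EFin ((4 * q)%N%:R / (3 * q).+1%:R + e))).
  rewrite constructive_ereal.lee_fin -lerBlDr -addn1 natrD !natrM.
  rewrite ler_pdivlMr; last by lra.
  nra.
rewrite constructive_ereal.EFinD; apply: constructive_ereal.leeD2r.
apply: ereal.ereal_sup_ubound; exists (4 * q)%N, (3 * q).+1; split=> // sub.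
apply: (delta_notin_pow m_ge1 coprime_3m); apply: sub.
exact: (delta_symbolic k m_ge1 coprime_3m).
Qed.
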